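(* Let $1<\delta\le 2$. Then $\mathcal{L}(F_\delta^P)=0$, where $\mathcal{L}$ denotes the Lebesgue measure.
   Context: For a real number $\beta>1$ let $T_\beta:[0,1]\to[0,1]$, $T_\beta x=\beta x-\lfloor\beta x\rfloor$, and for $x\in[0,1]$, $n\ge 1$ let $\varepsilon_n(x,\beta)=\lfloor\beta T_\beta^{n-1}x\rfloor$. For $n\ge1$ the $n$th cylinder of $\beta$ in the parameter space is $$I^P_n(\beta)=\{\beta'\in(1,+\infty):\varepsilon_1(1,\beta')=\varepsilon_1(1,\beta),\ldots,\varepsilon_n(1,\beta')=\varepsilon_n(1,\beta)\},$$ which is an interval; $|I^P_n(\beta)|$ is its length. The upper density of $\beta$ is $$\overline{D}(\beta)=\limsup_{n\to\infty}\frac{-\log_\beta|I^P_n(\beta)|}{n}.$$ For $1<\delta\le2$, the $\delta$-irregular set in parameter space is $F_\delta^P=\{\beta\in(1,+\infty):\overline{D}(\beta)=\delta\}$. *)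

(* Defs.v *)
From HB Require Import structures.
From mathcomp Require Import all_boot all_order all_algebra.
From mathcomp Require Import all_classical all_reals all_analysis.

Set Implicit Arguments.
Unset Strict Implicit.
Unset Printing Implicit Defensive.

Import Order.TTheory GRing.Theory Num.Theory.
Import numFieldNormedType.Exports.

Local Open Scope classical_set_scope.
Local Open Scope ring_scope.

Definition beta_map {R : realType} (beta x : R) : R :=
  beta * x - (Num.floor (beta * x))%:~R.

(* Digits are indexed from n = 1; the value at n = 0 is never used. *)
Definition beta_digit {R : realType} (n : nat) (x beta : R) : int :=
  Num.floor (beta * iter n.-1 (beta_map beta) x).

Definition param_cylinder {R : realType} (n : nat) (beta : R) : set R :=
  [set beta' | 1 < beta' /\
    forall k : nat, (1 <= k <= n)%N ->
      beta_digit k 1 beta' = beta_digit k 1 beta].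

(* For beta > 1 and n >= 1 the cylinder is a bounded nondegenerate interval (its
   first digit bounds it), so its Lebesgue measure is its length, and neither
   [fine] nor [ln] is applied at a degenerate value. *)
Definition cylinder_length {R : realType} (n : nat) (beta : R) : R :=
  fine (lebesgue_measure (param_cylinder n beta)).

Definition log_base {R : realType} (b x : R) : R := ln x / ln b.

(* The limsup is extended-real valued, so it may be infinite; the meaningless
   term n = 0 does not affect it. *)
Definition upper_density {R : realType} (beta : R) : \bar R :=
  limn_esup (fun n : nat =>
    (- log_base beta (cylinder_length n beta) / n%:R)%:E).

(* Measurability of this set is not asserted: [lebesgue_measure] extends to all
   sets as the outer measure, so value 0 means Lebesgue-measurable and null. *)
Definition irregular_set {R : realType} (delta : R) : set R :=
  [set beta | 1 < beta /\ upper_density beta = delta%:E].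

(* Main.v *)
Require Import Defs.
From mathcomp Require Import all_boot all_order all_algebra.
From mathcomp Require Import all_classical all_reals all_analysis.
From mathcomp Require Import lra.
Import Order.TTheory GRing.Theory Num.Theory.
Import numFieldNormedType.Exports.
Local Open Scope classical_set_scope.
Local Open Scope ring_scope.

Set Implicit Arguments.
Unset Strict Implicit.

(** Parameters up to [b] produce only about [b ^ n] different digit words of
length [n], so the parameters lying in a cylinder much shorter than [b ^ (- n)]
fill a set of small measure, and the Borel-Cantelli lemma applies.

Counting.  Greedy expansions are monotone for the lexicographic order: if
[x <= y] and [beta <= b], then either the first digit of [x] in base [beta] is
smaller than that of [y] in base [b], or the two digits agree and
[T_beta x <= T_b y].  Hence the words of all such [(x, beta)] belong to a list
built by recursion on [n] ([majorant_words], [beta_word_majorant]).  The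
recursion preserves a bound affine in [y], which at [y = 1] gives at most
[b / (b - 1) * b ^ n] words ([size_majorant_words]).  This is Renyi's bound on
the number of admissible words, obtained here for all bases up to [b] at once.

Borel-Cantelli.  If [b * r < 1], the parameters in [(1, b]] whose [n]-th cylinder
has measure at most [r ^ n] form a set of measure at most
[b / (b - 1) * (b * r) ^ n], which is summable; so almost no parameter has this
property for infinitely many [n] ([null_small_cylinders_io]).

Conclusion.  Let [1 < c] and let [beta] have upper density larger than [c].
Then its [n]-th cylinder is shorter than [beta ^ (- c n)] for infinitely many
[n].  With [1 < t < c], pick a rational [q] with [beta < q < beta ^ (c / t)]:
these cylinders are shorter than [r ^ n] for [r = q ^ (- t)], and [q * r < 1].
So [beta] belongs to a countable union of null sets ([null_upper_density_gt]).
Taking [c] between [1] and [delta] proves the theorem.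

Lebesgue measure is used as an outer measure throughout, so that no set has to
be shown measurable. *)

(** * Upper limits of sequences and of sets *)

Lemma lt_limn_esup (R : realType) (u : (\bar R)^nat) (c : \bar R) : (c < limn_esup u)%E ->
  forall N, exists2 n, (N <= n)%N & (c < u n)%E.
Proof.
move=> cu N; apply: contrapT => no; move: cu; apply/negP; rewrite -leNgt.
rewrite /limn_esup limf_esupE.
apply: ge_ereal_inf; exists (ereal_sup [set u n | n in [set n | (N <= n)%N]]).
  by exists [set n | (N <= n)%N] => //; exists N.
apply: ge_ereal_sup => _ [n /= Nn <-]; rewrite leNgt; apply/negP => cun.
by apply: no; exists n.
Qed.

(** The tails of the series of measures bound the measure of the upper limit; this
needs only countable subadditivity, hence the version for outer measures. *)
Lemma outer_borel_cantelli (T : Type) (R : realType)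
    (mu : {outer_measure set T -> \bar R}) (F : (set T)^nat) :
  (\sum_(0 <= n <oo) mu (F n) < +oo)%E -> mu (lim_sup_set F) = 0%E.
Proof.
move=> sumF; apply/eqP; rewrite eq_le outer_measure_ge0 andbT.
have tail0 : (\sum_(N <= n <oo) mu (F n))%E @[N --> \oo] --> 0%E.
  by apply: nneseries_tail_cvg => // k _; exact: outer_measure_ge0.
rewrite -(cvg_lim _ tail0) //; apply: lime_ge; first by apply/cvg_ex; exists 0%E.
apply: nearW => N; apply: le_trans (outer_measure_sigma_subadditive_tail mu N F).
rewrite setC_I; apply: le_outer_measure; exact: bigcap_inf.
Qed.

(** * Lebesgue measure of arbitrary sets *)

(** [lebesgue_measure] is by definition the restriction of an outer measure, and
it takes the values of that outer measure on all sets; the next four lemmas make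
this available without measurability hypotheses. *)
Section Lebesgue.
Context {R : realType}.

Lemma lebesgue_ge0 (A : set R) : (0 <= lebesgue_measure A)%E.
Proof. exact: outer_measure_ge0. Qed.

Lemma le_lebesgue (A B : set R) :
  A `<=` B -> (lebesgue_measure A <= lebesgue_measure B)%E.
Proof. by move=> AB; exact: le_outer_measure. Qed.

Lemma lebesgue_subadditive (F : (set R)^nat) n :
  (lebesgue_measure (\big[setU/set0]_(i < n) F i)
   <= \sum_(i < n) lebesgue_measure (F i))%E.
Proof. exact: outer_measure_subadditive. Qed.

Lemma lebesgue_sigma_subadditive (F : (set R)^nat) :
  (lebesgue_measure (\bigcup_n F n)
   <= \sum_(0 <= n <oo) lebesgue_measure (F n))%E.
Proof. exact: outer_measure_sigma_subadditive. Qed.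

End Lebesgue.

(** * Counting digit words *)

Section Words.
Context {R : realType}.
Implicit Types beta b x y : R.

Definition beta_word n x beta : seq int :=
  [seq beta_digit k x beta | k <- iota 1 n].

Lemma beta_wordS n x beta : beta_word n.+1 x beta =
  Num.floor (beta * x) :: beta_word n (beta_map beta x) beta.
Proof.
rewrite /beta_word /= (iotaDl 1 1) -map_comp.
congr cons; apply/eq_in_map => k; rewrite mem_iota => /andP[k1 _] /=.
by case: k k1 => // k _; rewrite /beta_digit /= -iterSr.
Qed.

Lemma beta_map_itv beta x : 0 <= beta_map beta x < 1.
Proof. by rewrite /beta_map subr_ge0 floor_le ltrBlDl -intrD1 floorD1_gt. Qed.

(** A word that is lexicographically below the expansion of [y] in base [b] either
starts with a smaller digit, after which the remaining point is only known to be
at most [1], or starts with the same digit and stays below [beta_map b y]. *)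
Fixpoint majorant_words b n y : seq (seq int) :=
  if n is m.+1 then
    [seq Posz d :: w | d <- iota 0 `|Num.floor (b * y)|%N,
                       w <- majorant_words b m 1]
    ++ [seq Num.floor (b * y) :: w | w <- majorant_words b m (beta_map b y)]
  else [:: [::]].

(** Lexicographic monotonicity of greedy expansions in the point and the base: when
the first digits agree, [beta_map beta x <= beta_map b y] because
[beta * x <= b * y] and the same integer is subtracted from both. *)
Lemma beta_word_majorant b n x y beta :
  0 < beta <= b -> 0 <= x <= y -> beta_word n x beta \in majorant_words b n y.
Proof.
move=> /andP[beta0 betab].
elim: n x y => [//|n IH] x y /andP[x0 xy]; rewrite beta_wordS /= mem_cat.
have bxy : beta * x <= b * y by apply: ler_pM => //; exact: ltW.
have dx0 : 0 <= Num.floor (beta * x) by rewrite floor_ge0 mulr_ge0 // ltW.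
have := le_floor bxy; rewrite le_eqVlt => /orP[/eqP dxy|dxy]; apply/orP.
- right; rewrite dxy; apply: map_f; apply: IH.
  by rewrite (andP (beta_map_itv beta x)).1 /beta_map dxy lerD2r.
- left; apply/allpairsP; exists (`|Num.floor (beta * x)|%N,
    beta_word n (beta_map beta x) beta) => /=; split.
  + rewrite mem_iota /= add0n -ltz_nat !gez0_abs //.
    exact: ltW (le_lt_trans dx0 dxy).
  + by apply: IH; have /andP[-> /ltW] := beta_map_itv beta x.
  + by rewrite gez0_abs.
Qed.

(** Write [1 + A_n * y] for the bound.  With [d] the first digit of [y], the two
branches give [d * (1 + A_n) + 1 + A_n * (b * y - d) = 1 + d + A_n * b * y],
and [d <= b * y], so the bound persists for [A_(n+1) = b * (1 + A_n)]; with
[A_0 = 0] this recurrence has the solution below. *)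
Lemma size_majorant_words b n y : 1 < b -> 0 <= y ->
  (size (majorant_words b n y))%:R <= 1 + (b ^+ n - 1) * (b / (b - 1)) * y.
Proof.
move=> b1; elim: n y => [|n IH] y y0 /=; first by rewrite subrr !mul0r addr0.
have b0 : 0 <= b by apply/ltW/(lt_trans _ b1).
have by0 : 0 <= b * y by exact: mulr_ge0.
have fl0 : 0 <= Num.floor (b * y) by rewrite floor_ge0.
rewrite size_cat size_allpairs size_iota size_map natrD natrM natr_absz.
rewrite ger0_norm //; set fl := (Num.floor _)%:~R.
have fl_ge0 : 0 <= fl by rewrite /fl ler0z.
have fl_le : fl <= b * y by exact: floor_le.
have s1 := IH 1 ler01.
have /andP[by' _] := beta_map_itv b y.
have s2 := IH _ by'.
apply: le_trans (lerD (ler_wpM2l fl_ge0 s1) s2) _.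
rewrite /beta_map -/fl mulr1 exprS.
have K : (b - 1) * (b / (b - 1)) = b by rewrite mulrC divfK // subr_eq0 gt_eqF.
move: (b / (b - 1)) (b ^+ n) K => k p K.
nra.
Qed.

End Words.

(** * Parameters with short cylinders *)

Section Cylinders.
Context {R : realType}.
Implicit Types beta b : R.

Lemma mem_param_cylinder n beta beta' : 1 < beta' ->
  beta_word n 1 beta' = beta_word n 1 beta -> param_cylinder n beta beta'.
Proof.
move=> b1 /eq_in_map H; split => // k kn; apply: H.
by rewrite mem_iota add1n ltnS.
Qed.

(** Split the set according to the digit word: each part lies in the common cylinder
of its points, whose measure is at most [r]. *)
Lemma measure_small_cylinders n b r : 1 < b -> 0 <= r ->
  (lebesgue_measure [set beta : R | [/\ (1 < beta)%R, (beta <= b)%R &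
     lebesgue_measure (param_cylinder n beta) <= r%:E]]
   <= (b / (b - 1) * b ^+ n * r)%:E)%E.
Proof.
move=> b1 r0; set E := [set _ | _]; set ws := majorant_words b n 1.
pose F i := E `&` [set beta | beta_word n 1 beta = nth [::] ws i].
have EF : E `<=` \big[setU/set0]_(i < size ws) F i.
  move=> beta Ebeta; rewrite -bigcup_mkord.
  have [b1' bb _] := Ebeta.
  have wP : beta_word n 1 beta \in ws.
    by apply: beta_word_majorant; rewrite ?lexx ?ler01 // bb (lt_trans ltr01 b1').
  exists (index (beta_word n 1 beta) ws); first by rewrite /= index_mem.
  by split => //=; rewrite nth_index.
have Fr i : (lebesgue_measure (F i) <= r%:E)%E.
  (* A nonempty part lies in the cylinder of any of its points. *)
  have [->|/set0P[beta [[_ _ cr] bw]]] := eqVneq (F i) set0.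
    by rewrite measure0 lee_fin.
  apply: le_trans cr; apply: le_lebesgue => beta' [[b1' _ _] bw'].
  by apply: mem_param_cylinder => //; rewrite bw'.
apply: le_trans (le_lebesgue EF) _.
apply: le_trans (lebesgue_subadditive F _) _.
apply: (@le_trans _ _ (\sum_(i < size ws) r%:E)%E); first exact: lee_sum.
rewrite sumEFin lee_fin sumr_const card_ord -mulr_natl ler_wpM2r //.
apply: le_trans (size_majorant_words n b1 ler01) _.
have : 1 <= b / (b - 1) by rewrite ler_pdivlMr ?subr_gt0 // mul1r gerBl.
by rewrite mulr1; move: (b / (b - 1)) (b ^+ n) => k p; nra.
Qed.

Lemma null_small_cylinders_io b r : 1 < b -> 0 <= r -> b * r < 1 ->
  lebesgue_measure (lim_sup_set (fun n => [set beta : R |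
    [/\ 1 < beta, beta <= b &
        (lebesgue_measure (param_cylinder n beta) <= (r ^+ n)%:E)%E]])) = 0%E.
Proof.
move=> b1 r0 br1; apply: outer_borel_cantelli.
have b0 : 0 < b by apply: lt_trans b1.
have k0 : 0 <= b / (b - 1) by rewrite divr_ge0 ?ltW // subr_gt0.
have br0 : 0 <= b * r by rewrite mulr_ge0 // ltW.
apply: (@le_lt_trans _ _
  (\sum_(0 <= n <oo) (geometric (b / (b - 1)) (b * r) n)%:E)%E).
  apply: lee_nneseries => [n _ _|n _]; first exact: lebesgue_ge0.
  have := measure_small_cylinders n b1 (exprn_ge0 n r0).
  by rewrite /geometric /= exprMn mulrA.
have /cvg_geometric_series cvgS : `|b * r| < 1 by rewrite ger0_norm.
rewrite (_ : limn _ = (b / (b - 1) / (1 - b * r))%:E) ?ltry //.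
apply/cvg_lim => //.
under eq_fun do rewrite sumEFin.
apply: cvg_EFin; first exact: nearW.
exact: cvgS.
Qed.

End Cylinders.

(** * Upper density *)

Section Density.
Context {R : realType}.
Implicit Types beta c : R.

(** The hypothesis forces the logarithm of the length to be negative.  As [ln]
vanishes at [0] and [fine] at infinite values, the measure of the cylinder is then
finite, and bounding its logarithm bounds the measure itself. *)
Lemma small_cylinder_of_density n beta c : 1 < beta -> 0 < c -> (0 < n)%N ->
  c < - log_base beta (cylinder_length n beta) / n%:R ->
  (lebesgue_measure (param_cylinder n beta)
     <= (expR (- (c * ln beta)) ^+ n)%:E)%E.
Proof.
move=> beta1 c0 n0.
have lb0 : 0 < ln beta by rewrite ln_gt0.
have nR0 : (0 : R) < n%:R by rewrite ltr0n.
rewrite ltr_pdivlMr // /log_base -mulNr ltr_pdivlMr // ltrNr => lnl.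
have lnl0 : ln (cylinder_length n beta) < 0.
  by apply: lt_trans lnl _; rewrite oppr_lt0 !mulr_gt0.
move: lnl lnl0; rewrite /cylinder_length.
case: (lebesgue_measure _) => [l| |] /= lnl; last 2 first.
- by rewrite ln0 ?ltxx.
- by rewrite ln0 ?ltxx.
rewrite lee_fin -expRM_natl => _.
have [l0|l0] := leP l 0; first exact: le_trans l0 (expR_ge0 _).
rewrite -[leLHS]lnK // ler_expR.
by apply: le_trans (ltW lnl) _; rewrite mulrN lerN2 mulrCA mulrA.
Qed.

(** Almost every parameter has upper density at most [1]. *)
Lemma null_upper_density_gt c : 1 < c ->
  lebesgue_measure [set beta : R | 1 < beta /\ (c%:E < upper_density beta)%E]
  = 0%E.
Proof.
move=> c1; set E := [set _ | _].
pose t := (1 + c) / 2.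
have t1 : 1 < t by rewrite /t; lra.
have tc : t < c by rewrite /t; lra.
pose D (q : R) := if 1 < q then lim_sup_set (fun n => [set beta : R |
  [/\ 1 < beta, beta <= q & (lebesgue_measure (param_cylinder n beta)
     <= (expR (- (t * ln q)) ^+ n)%:E)%E]]) else set0.
have D0 q : lebesgue_measure (D q) = 0%E.
  rewrite /D; case: ifPn => [q1|_]; last by rewrite measure0.
  apply: null_small_cylinders_io => //.
  rewrite -{1}[q]lnK ?posrE ?(lt_trans ltr01) // -expRD expR_lt1.
  by have := ln_gt0 q1; nra.
pose F n := if unpickle n is Some q then D (ratr q) else set0.
have EF : E `<=` \bigcup_n F n.
  move=> beta [beta1 cD].
  have lb0 : 0 < ln beta by rewrite ln_gt0.
  have beta0 : 0 < beta by apply: lt_trans beta1.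
  (* A rational between [beta] and [beta ^ (c / t)] dominates [beta], while its
     power with exponent [- t] still exceeds that of [beta] with exponent [- c]. *)
  have : beta < expR (c / t * ln beta).
    rewrite -{1}[beta]lnK // ltr_expR ltr_pMl //.
    by rewrite ltr_pdivlMr ?mul1r // (lt_trans ltr01).
  move=> /rat_in_itvoo[q]; rewrite in_itv /= => /andP[bq qb].
  exists (pickle q) => //; rewrite /F pickleK /D (lt_trans beta1 bq).
  have q0 : 0 < ratr q :> R by apply: lt_trans bq.
  have tq : t * ln (ratr q) <= c * ln beta.
    have : ln (ratr q) < c / t * ln beta by rewrite -ltr_expR lnK.
    move=> /ltW; rewrite mulrAC ler_pdivlMr ?(lt_trans ltr01) //.
    by rewrite mulrC.
  move=> N _.
  (* The term at [n = 0] carries no information, so it is skipped. *)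
  have [n Nn cn] := lt_limn_esup cD (maxn N 1).
  move: Nn; rewrite geq_max => /andP[Nn n0].
  exists n => //; split => //; first exact: ltW.
  apply: le_trans (small_cylinder_of_density beta1 _ n0 cn) _.
    exact: lt_trans c1.
  by rewrite lee_fin lerXn2r ?nnegrE ?expR_ge0 // ler_expR lerN2.
apply/eqP; rewrite eq_le lebesgue_ge0 andbT.
apply: le_trans (le_lebesgue EF) _.
apply: le_trans (lebesgue_sigma_subadditive F) _.
rewrite eseries0 // => n _ _; rewrite /F.
by case: unpickle => [q|]; rewrite ?measure0.
Qed.

End Density.

Unset Implicit Arguments.

Theorem corollary1p3 (R : realType) (delta : R) (hdelta : 1 < delta <= 2) :
  lebesgue_measure (irregular_set delta) = 0%E.
Proof.
have /andP[d1 _] := hdelta.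
pose c := (1 + delta) / 2.
have c1 : 1 < c by rewrite /c; lra.
have cd : c < delta by rewrite /c; lra.
apply/eqP; rewrite eq_le lebesgue_ge0 andbT -(null_upper_density_gt c1).
by apply: le_lebesgue => beta [b1 bD]; split => //; rewrite bD lte_fin.
Qed.
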